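(* Let $f : (A, \mathfrak{m}) \to (B, \mathfrak{n})$ be a pure local ring homomorphism between commutative local rings such that $B$ is Noetherian and the fiber ring $B/\mathfrak{m}B$ is Artinian. Then $\dim A = \dim B$ and $\operatorname{depth} A \ge \operatorname{depth} B$.
   Context: All rings are commutative with identity. A ring homomorphism $f : A \to B$ is called pure if for every $A$-module $W$ the map $j_W : W \to B \otimes_A W$, $j_W(w) = 1 \otimes w$, is injective. Here $\mathfrak{m}$ and $\mathfrak{n}$ are the maximal ideals of the local rings $A$ and $B$, $\mathfrak{m}B$ is the ideal of $B$ generated by $f(\mathfrak{m})$, $\dim$ is Krull dimension, and $\operatorname{depth}$ of a Noetherian local ring is the common length of maximal regular sequences contained in its maximal ideal. (It is known that if $A \to B$ is pure and $B$ is Noetherian, then $A$ is Noetherian, so $\operatorname{depth} A$ makes sense.) *)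

(* Defs.v *)
From HB Require Import structures.
From mathcomp Require Import all_boot all_algebra ring_quotient.
From mathcomp Require Import boolp classical_sets.
From mathcomp.multinomials Require Import freeg.

Set Implicit Arguments.
Unset Strict Implicit.
Unset Printing Implicit Defensive.

Import GRing.Theory.

Local Open Scope ring_scope.
Local Open Scope classical_set_scope.
Local Open Scope quotient_scope.

(* Rings are commutative and unital; [comPzRingType] does not exclude the zero
   ring, so that a quotient by an arbitrary ideal is again such a ring. *)

Section Ideals.
Variable R : comPzRingType.
Implicit Types (I J P S : set R) (s : seq R).

Definition is_ideal I : Prop :=
  [/\ I 0, forall x y, I x -> I y -> I (x + y)
         & forall a x, I x -> I (a * x)].

Definition gen_ideal S : set R := smallest is_ideal S.

Definition is_prime P : Prop :=
  [/\ is_ideal P, ~ P 1 & forall x y, P (x * y) -> P x \/ P y].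

Definition is_maximal I : Prop :=
  [/\ is_ideal I, ~ I 1
    & forall J, is_ideal J -> ~ J 1 -> I `<=` J -> J = I].

Definition local_ring I : Prop :=
  is_maximal I /\ forall J, is_maximal J -> J = I.

Lemma gen_ideal_is_ideal S : is_ideal (gen_ideal S).
Proof.
split=> [J [[J0 _ _] _]|x y xS yS J JS|a x xS J JS] //.
  by case: (JS) => -[_ JD _] _; apply: JD; [apply: xS|apply: yS].
by case: (JS) => -[_ _ JM] _; apply: JM; apply: xS.
Qed.

(* Boolean form of [gen_ideal], as required by the library's quotients. *)
Definition gen_idealb S : {pred R} := fun x => x \in gen_ideal S.

Lemma gen_idealb_zmod S : zmod_closed (gen_idealb S).
Proof.
have [I0 ID IM] := gen_ideal_is_ideal S.
split=> [|x y]; rewrite !unfold_in /gen_idealb !inE // => xI yI.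
by apply: ID => //; rewrite -mulN1r; apply: IM.
Qed.

HB.instance Definition _ S :=
  GRing.isZmodClosed.Build R (gen_idealb S) (gen_idealb_zmod S).

(* The quotient of R by the ideal generated by S. *)
Definition qring S := Quotient.quot (gen_idealb S).

HB.instance Definition _ S := GRing.Zmodule.on (qring S).
HB.instance Definition _ S := EqQuotient.on (qring S).

Definition qproj S : R -> qring S := \pi_(qring S).

Lemma qprojE S x y : (qproj S x = qproj S y) <-> gen_ideal S (x - y).
Proof.
have E : (gen_idealb S (x - y)) = (qproj S x == qproj S y).
  exact: (Quotient.idealrBE (gen_idealb S) x y).
by rewrite -[gen_ideal S _]in_setE -[_ \in _]/(gen_idealb S (x - y)) E;
  split=> /eqP.
Qed.

Lemma qprojK S (x : qring S) : qproj S (repr x) = x.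
Proof. exact: reprK. Qed.

Lemma qproj_is_zmod_morphism S : zmod_morphism (qproj S).
Proof. exact: (raddfB (\pi_(Quotient.quot (gen_idealb S)))). Qed.

HB.instance Definition _ S :=
  GRing.isZmodMorphism.Build R (qring S) (qproj S) (qproj_is_zmod_morphism S).

Definition qone S : qring S := qproj S 1.
Definition qmul S (x y : qring S) : qring S := qproj S (repr x * repr y).

Lemma qproj_mul S x y : qmul (qproj S x) (qproj S y) = qproj S (x * y).
Proof.
have [_ ID IM] := gen_ideal_is_ideal S.
apply/qprojE; set x' := repr _; set y' := repr _.
have xx : gen_ideal S (x' - x) by apply/qprojE; exact: qprojK.
have yy : gen_ideal S (y' - y) by apply/qprojE; exact: qprojK.
have -> : x' * y' - x * y = y' * (x' - x) + x * (y' - y).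
  by rewrite !mulrBr [y' * x']mulrC [y' * x]mulrC addrA addrNK.
by apply: ID; apply: IM.
Qed.

Lemma qmulA S : associative (@qmul S).
Proof.
by move=> x y z; rewrite -[x]qprojK -[y]qprojK -[z]qprojK !qproj_mul mulrA.
Qed.

Lemma qmulC S : commutative (@qmul S).
Proof. by move=> x y; rewrite /qmul mulrC. Qed.

Lemma qmul1 S : left_id (qone S) (@qmul S).
Proof. by move=> x; rewrite -[x]qprojK /qone qproj_mul mul1r. Qed.

Lemma qmulDl S : left_distributive (@qmul S) +%R.
Proof.
move=> x y z; rewrite -[x]qprojK -[y]qprojK -[z]qprojK -raddfD !qproj_mul.
by rewrite mulrDl raddfD.
Qed.

HB.instance Definition _ S := GRing.Zmodule_isComPzRing.Build (qring S)
  (@qmulA S) (@qmulC S) (@qmul1 S) (@qmulDl S).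

Lemma qproj_is_monoid_morphism S : monoid_morphism (qproj S).
Proof. by split=> // x y; rewrite -qproj_mul. Qed.

HB.instance Definition _ S :=
  GRing.isMonoidMorphism.Build R (qring S) (qproj S)
    (qproj_is_monoid_morphism S).

End Ideals.

Definition noetherian (R : comPzRingType) : Prop :=
  forall I : nat -> set R, (forall k, is_ideal (I k)) ->
    (forall k, I k `<=` I k.+1) ->
    exists N, forall k, (N <= k)%N -> I k = I N.

Definition artinian (R : comPzRingType) : Prop :=
  forall I : nat -> set R, (forall k, is_ideal (I k)) ->
    (forall k, I k.+1 `<=` I k) ->
    exists N, forall k, (N <= k)%N -> I k = I N.

Section KrullDim.
Variable R : comPzRingType.

(* A chain P 0 < ... < P n of primes has length n. *)
Definition has_prime_chain (n : nat) : Prop :=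
  exists P : nat -> set R,
    (forall i, (i <= n)%N -> is_prime (P i)) /\
    (forall i, (i < n)%N -> P i `<` P i.+1).

(* The supremum of the lengths of chains of primes: [Some d] if it is d, and
   [None] if the lengths are unbounded.  (For the zero ring, which has no
   prime ideal, the value is irrelevant.) *)
Definition krull_dim : option nat :=
  xget None [set Some d | d in
    [set d | has_prime_chain d /\
             forall n, has_prime_chain n -> (n <= d)%N]].

End KrullDim.

Section Depth.
Variable R : comPzRingType.
Implicit Types (I : set R) (s : seq R).

(* [GRing.lreg x] says that multiplication by x is injective. *)
Definition regular_seq s : Prop :=
  (forall i, (i < size s)%N ->
     GRing.lreg (qproj [set` take i s] s`_i)) /\
  (1 : qring [set` s]) <> 0.

Definition maximal_regular_seq I s : Prop :=
  [/\ regular_seq s, [set` s] `<=` I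
    & forall x, I x -> ~ regular_seq (rcons s x)].

Definition is_depth I (d : nat) : Prop :=
  (exists s, maximal_regular_seq I s) /\
  (forall s, maximal_regular_seq I s -> size s = d).

(* For (R, I) Noetherian local there is a unique d with [is_depth I d]; the
   default value 0 is not used. *)
Definition depth I : nat := xget 0%N [set d | is_depth I d].

End Depth.

Definition is_subgroup (V : zmodType) (H : set V) : Prop :=
  H 0 /\ forall x y, H x -> H y -> H (x - y).

Section Tensor.
Variables (A B : comPzRingType) (f : {rmorphism A -> B}) (W : lmodType A).

Local Notation free := {freeg (B * W)%type}.

Definition fgen (b : B) (w : W) : free := Freeg [:: (1, (b, w))].

(* B is an A-module through f. *)
Definition tensor_rel : set free :=
  [set x | [\/ exists b b' w, x = fgen (b + b') w - fgen b w - fgen b' w,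
               exists b w w', x = fgen b (w + w') - fgen b w - fgen b w' |
               exists b a w, x = fgen (b * f a) w - fgen b (a *: w)]].

Definition tensor_sub : {pred free} :=
  fun x => x \in smallest (@is_subgroup _) tensor_rel.

Lemma tensor_sub_zmod : zmod_closed tensor_sub.
Proof.
split=> [|x y]; rewrite !unfold_in /tensor_sub !inE; first by move=> H [[]].
by move=> xS yS H HS; case: (HS) => -[_ HB] _; apply: HB; [apply: xS|apply: yS].
Qed.

HB.instance Definition _ :=
  GRing.isZmodClosed.Build free tensor_sub tensor_sub_zmod.

(* The underlying abelian group of the tensor product of B and W over A. *)
Definition tensor := Quotient.quot tensor_sub.

HB.instance Definition _ := GRing.Zmodule.on tensor.
HB.instance Definition _ := EqQuotient.on tensor.

Definition tens (b : B) (w : W) : tensor := \pi_tensor (fgen b w).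

Lemma pi_tensor_is_zmod_morphism : zmod_morphism \pi_tensor.
Proof. exact: (raddfB (\pi_(Quotient.quot tensor_sub))). Qed.

Lemma pi_tensorE x y :
  \pi_tensor x = \pi_tensor y <-> smallest (@is_subgroup _) tensor_rel (x - y).
Proof.
have E : tensor_sub (x - y) = (\pi_tensor x == \pi_tensor y).
  exact: (Quotient.idealrBE tensor_sub x y).
rewrite -[smallest _ _ _]in_setE -[_ \in _]/(tensor_sub (x - y)) E.
by split=> /eqP.
Qed.

Lemma pi_tensor_rel x : tensor_rel x -> \pi_tensor x = 0.
Proof.
move=> xr; rewrite -(subrr (\pi_tensor 0)) -pi_tensor_is_zmod_morphism.
by apply/pi_tensorE; rewrite !subr0 => H [_]; apply.
Qed.

Lemma tensDl b b' w : tens (b + b') w = tens b w + tens b' w.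
Proof.
apply/eqP; rewrite -subr_eq0 opprD addrA /tens -!pi_tensor_is_zmod_morphism.
by apply/eqP/pi_tensor_rel; apply: Or31; exists b, b', w.
Qed.

Lemma tensDr b w w' : tens b (w + w') = tens b w + tens b w'.
Proof.
apply/eqP; rewrite -subr_eq0 opprD addrA /tens -!pi_tensor_is_zmod_morphism.
by apply/eqP/pi_tensor_rel; apply: Or32; exists b, w, w'.
Qed.

Lemma tensZ b a w : tens (b * f a) w = tens b (a *: w).
Proof.
apply/eqP; rewrite -subr_eq0 /tens -pi_tensor_is_zmod_morphism.
by apply/eqP/pi_tensor_rel; apply: Or33; exists b, a, w.
Qed.

Lemma tensor_univ (M : zmodType) (h : B -> W -> M) :
    (forall b b' w, h (b + b') w = h b w + h b' w) ->
    (forall b w w', h b (w + w') = h b w + h b w') ->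
    (forall b a w, h (b * f a) w = h b (a *: w)) ->
  exists2 u : tensor -> M, zmod_morphism u & forall b w, u (tens b w) = h b w.
Proof.
move=> hDl hDr hZ.
pose g (x : free) : M := fglift (fun k : B * W => h k.1 k.2 : zmodule M) x.
have gB : zmod_morphism g.
  exact: (lift_is_additive (fun k : B * W => h k.1 k.2 : zmodule M)).
have g0 : g 0 = 0 by rewrite -[X in g X](subrr 0) gB subrr.
have gU b w : g (fgen b w) = h b w by rewrite /g liftU scale1r.
have gpi x y : \pi_tensor x = \pi_tensor y -> g x = g y.
  move=> /pi_tensorE /(_ [set z | g z = 0]) xy.
  apply/eqP; rewrite -subr_eq0 -gB; apply/eqP; apply: xy; split.
    by split=> // z t /= z0 t0; rewrite gB z0 t0 subrr.
  move=> _ [[b [b' [w ->]]]|[b [w [w' ->]]]|[b [a [w ->]]]] /=;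
    rewrite !gB !gU ?hDl ?hDr ?hZ ?subrr //.
  - by rewrite addrAC addrK subrr.
  - by rewrite addrAC addrK subrr.
exists (fun t => g (repr t)) => [x y|b w].
  rewrite -gB; apply: gpi.
  by rewrite pi_tensor_is_zmod_morphism !reprK.
by rewrite -gU; apply: gpi; rewrite reprK.
Qed.

End Tensor.

Definition pure (A B : comPzRingType) (f : {rmorphism A -> B}) : Prop :=
  forall W : lmodType A, injective (fun w : W => tens f 1 w).

(* Main.v *)
From HB Require Import structures.
Require Import Defs.
From mathcomp Require Import all_boot all_algebra ring.
From mathcomp Require Import boolp classical_sets.

(** The comparison is elementary once purity is used through one consequence:
    tensoring with [A / I] shows that [I B] contracts to [I] for every ideal
    [I] of [A] ([pure_contraction]).  Hence ascending chains of ideals of [A]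
    can be compared in [B], so that [A] is Noetherian, and every prime of [A]
    is contracted from [B].  On the other side, an Artinian ring has only
    maximal primes, so [n] is the only prime of [B] containing the image of
    [m].

    Dimension.  In a Noetherian local ring, if [e] elements lie in no prime
    except the maximal ideal, then chains of primes have length at most [e]:
    this is Krull's height theorem ([krull_height]).  Conversely, if the chains
    of [B] have length at most [e], such elements exist, and by prime avoidance
    they can be chosen in the image of [m], because no other prime of [B]
    contains this image ([parameters_exist]).  As their preimages lie in no
    prime of [A] except [m], chains of [A] have length at most [e] as well.
    The reverse bound starts from parameters of [A], whose images lie in no
    prime of [B] except [n].  So the lengths of chains of primes have the same
    upper bounds in [A] and [B].

    Depth.  Prime avoidance in [A], applied to the contractions of the
    associated primes of [B / K], replaces a nonzerodivisor in [n] modulo [K]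
    by one in the image of [m].  So a maximal regular sequence of [B] can be
    taken in that image, and the contraction property makes it regular in [A].
    It then remains to know that in the Noetherian local ring [A] a regular
    sequence extends to a maximal one, and that all maximal regular sequences
    have the same length ([annihilates_regular]).

    Everything is expressed with ideals of one fixed ring: working in a
    quotient [R / J] means keeping [J] as a base ideal, and working in a
    localization at [Q] means allowing multipliers outside [Q]. *)

Set Implicit Arguments.
Unset Strict Implicit.
Unset Printing Implicit Defensive.

Import GRing.Theory.

Local Open Scope ring_scope.
Local Open Scope classical_set_scope.

(** * Ideals *)

Section IdealTheory.
Variable R : comPzRingType.
Implicit Types (I J K P Q : set R) (x y z : R) (s : seq R).

Lemma ideal0 I : is_ideal I -> I 0. Proof. by case. Qed.

Lemma idealD I x y : is_ideal I -> I x -> I y -> I (x + y).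
Proof. by case=> _ + _; apply. Qed.

Lemma idealMl I a x : is_ideal I -> I x -> I (a * x).
Proof. by case=> _ _; apply. Qed.

Lemma idealMr I a x : is_ideal I -> I x -> I (x * a).
Proof. by rewrite mulrC; apply: idealMl. Qed.

Lemma idealB I x y : is_ideal I -> I x -> I y -> I (x - y).
Proof.
by move=> iI Ix Iy; apply: idealD => //; rewrite -mulN1r; apply: idealMl.
Qed.

Lemma prime_ideal P : is_prime P -> is_ideal P. Proof. by case. Qed.

Lemma primeX P x k : is_prime P -> P (x ^+ k) -> P x.
Proof.
move=> [iP P1 PM]; elim: k => [|k IH]; first by rewrite expr0.
by rewrite exprS => /PM[|/IH].
Qed.

Lemma is_ideal_set0 : is_ideal [set (0 : R)].
Proof.
by split=> // [x y -> ->|a x ->] /=; rewrite ?addr0 ?mulr0.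
Qed.

Definition colon K (u : R) : set R := [set a | K (a * u)].

Lemma ideal_colon K u : is_ideal K -> is_ideal (colon K u).
Proof.
move=> iK; split=> [|x y Kx Ky|a x Kx]; rewrite /colon /=.
- by rewrite mul0r; apply: ideal0.
- by rewrite mulrDl; apply: idealD.
- by rewrite -mulrA; apply: idealMl.
Qed.

Lemma sub_colon K u : is_ideal K -> K `<=` colon K u.
Proof. by move=> iK a Ka; apply: idealMr. Qed.

(** The ideal [J + R x]. *)
Definition adjoin J x : set R := [set z | exists r, J (z - r * x)].

Lemma ideal_adjoin J x : is_ideal J -> is_ideal (adjoin J x).
Proof.
move=> iJ; split=> [|a b [r Jr] [r' Jr']|a b [r Jr]].
- by exists 0; rewrite mul0r subr0; apply: ideal0.
- exists (r + r').
  rewrite (_ : _ - _ = (a - r * x) + (b - r' * x)); last by ring.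
  exact: idealD.
- exists (a * r); rewrite (_ : _ - _ = a * (b - r * x)); last by ring.
  exact: idealMl.
Qed.

Lemma sub_adjoin J x : J `<=` adjoin J x.
Proof. by move=> z Jz; exists 0; rewrite mul0r subr0. Qed.

Lemma mem_adjoin J x : is_ideal J -> adjoin J x x.
Proof. by move=> iJ; exists 1; rewrite mul1r subrr; apply: ideal0. Qed.

Lemma adjoin_min J x K :
  is_ideal K -> J `<=` K -> K x -> adjoin J x `<=` K.
Proof.
move=> iK JK Kx z [r /JK Kr]; rewrite -[z](subrK (r * x)).
by apply: idealD => //; apply: idealMl.
Qed.

Lemma adjoinS J K x : J `<=` K -> adjoin J x `<=` adjoin K x.
Proof. by move=> JK z [r /JK]; exists r. Qed.

Lemma proper_adjoin J x : is_ideal J -> ~ J x -> J `<` adjoin J x.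
Proof.
move=> iJ nJx; split; first exact: sub_adjoin.
by move=> /(_ x (mem_adjoin x iJ)).
Qed.

Lemma adjoinC J x y : adjoin (adjoin J x) y = adjoin (adjoin J y) x.
Proof.
by rewrite eqEsubset; split=> z [r [r' Jz]]; exists r', r;
  rewrite addrAC.
Qed.

(** The ideal [J + (s)]; as a left fold, it grows along the prefixes of [s]. *)
Definition adjoins J s : set R := foldl adjoin J s.

Lemma ideal_adjoins J s : is_ideal J -> is_ideal (adjoins J s).
Proof. by elim: s J => //= x s IH J iJ; apply: IH; apply: ideal_adjoin. Qed.

Lemma sub_adjoins J s : J `<=` adjoins J s.
Proof.
elim: s J => [J z //|x s IH J]; apply: subset_trans (IH _); exact: sub_adjoin.
Qed.

Lemma adjoins_rcons J s x : adjoins J (rcons s x) = adjoin (adjoins J s) x.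
Proof. by rewrite /adjoins foldl_rcons. Qed.

Lemma adjoins_min J s K :
  is_ideal K -> J `<=` K -> [set` s] `<=` K -> adjoins J s `<=` K.
Proof.
move=> iK; elim: s J => [//|x s IH] J JK sK; apply: IH.
  by apply: adjoin_min => //; apply: sK; rewrite /= mem_head.
by move=> y ys; apply: sK; rewrite /= inE [_ \in _]ys orbT.
Qed.

Lemma mem_adjoins J s x : is_ideal J -> x \in s -> adjoins J s x.
Proof.
elim: s J => //= y s IH J iJ; rewrite inE => /orP[/eqP->|xs].
  by apply: sub_adjoins; apply: mem_adjoin.
by apply: IH => //; apply: ideal_adjoin.
Qed.

Lemma adjoins_adjoin J z s : adjoins (adjoin J z) s = adjoin (adjoins J s) z.
Proof. by elim: s J => //= x s IH J; rewrite -IH adjoinC. Qed.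

Lemma gen_idealE s : gen_ideal [set` s] = adjoins [set 0] s.
Proof.
rewrite eqEsubset; split=> [z|].
  apply; split; first exact/ideal_adjoins/is_ideal_set0.
  by move=> x; apply: mem_adjoins; apply: is_ideal_set0.
apply: adjoins_min; first exact: gen_ideal_is_ideal.
  by move=> x /= ->; exact: ideal0 (gen_ideal_is_ideal _).
by move=> x xs J [_]; apply; exact: xs.
Qed.

(** * Noetherian rings *)

Hypothesis noethR : noetherian R.

(** Otherwise the ideals violating [Pr] carry a strictly increasing sequence. *)
Lemma noeth_ind (Pr : set R -> Prop) :
  (forall I, is_ideal I ->
    (forall J, is_ideal J -> I `<` J -> Pr J) -> Pr I) ->
  forall I, is_ideal I -> Pr I.
Proof.
move=> step I0 iI0; apply: contrapT => nPr0.
pose bad := {I : set R | is_ideal I /\ ~ Pr I}.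
have next (I : bad) : exists J : bad, sval I `<` sval J.
  case: I => I [iI nPr]; apply: contrapT => /forallNP nJ.
  apply: (nPr); apply: step => // J iJ IJ; apply: contrapT => nPrJ.
  by apply: (nJ (exist _ J (conj iJ nPrJ))).
have [g gP] := choice next.
pose u k := iter k g (exist _ I0 (conj iI0 nPr0) : bad).
have [||N uN] := noethR (I := fun k => sval (u k)).
- by move=> k; case: (u k) => ? [].
- by move=> k; case: (gP (u k)).
have [_] := gP (u N); apply; rewrite -[g _]/(u N.+1) (uN N.+1) //.
Qed.

Lemma noeth_max (F : set R -> Prop) I : is_ideal I -> F I ->
  exists J, [/\ is_ideal J, I `<=` J, F J &
    forall K, is_ideal K -> F K -> J `<=` K -> K = J].
Proof.
move=> iI; elim/noeth_ind: iI => {}I iI IH FI.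
have [[J [iJ IJ FJ]]|nJ] :=
    pselect (exists J, [/\ is_ideal J, I `<` J & F J]).
  have [K [iK JK FK maxK]] := IH J iJ IJ FJ.
  by exists K; split=> //; apply: subset_trans JK; case: IJ.
exists I; split=> // K iK FK IK; apply/eqP; rewrite eq_sym; apply/eqP.
apply: contrapT => neK; apply: nJ; exists K; split=> //; split=> // KI.
by apply: neK; rewrite eqEsubset.
Qed.

(** An ideal maximal among those missing a multiplicative set is prime. *)
Lemma prime_avoiding (S J : set R) :
    S 1 -> (forall x y, S x -> S y -> S (x * y)) ->
    is_ideal J -> (forall x, S x -> ~ J x) ->
  exists P, [/\ is_prime P, J `<=` P & forall x, S x -> ~ P x].
Proof.
move=> S1 SM iJ SJ.
have [P [iP JP SP maxP]] :=
  noeth_max (F := fun K => forall x, S x -> ~ K x) iJ SJ.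
exists P; split=> //; split=> // [|x y Pxy]; first exact: SP.
have meet z : ~ P z -> exists2 s, S s & adjoin P z s.
  move=> nPz; apply: contrapT => nS; apply: nPz.
  have <- : adjoin P z = P; last exact: mem_adjoin.
  apply: maxP; [exact: ideal_adjoin | | exact: sub_adjoin].
  by move=> s Ss Ps; apply: nS; exists s.
have [Px|/meet[s Ss [r Pr]]] := pselect (P x); first by left.
have [Py|/meet[t St [r' Pr']]] := pselect (P y); first by right.
exfalso; apply: (SP (s * t)); first exact: SM.
rewrite (_ : s * t = (s - r * x) * t + (r * x) * (t - r' * y)
                      + r * r' * (x * y)); last by ring.
apply: idealD => //; last exact: idealMl.
by apply: idealD => //; [apply: idealMr | apply: idealMl].
Qed.

Lemma radical_primes J x : is_ideal J ->
  (forall P, is_prime P -> J `<=` P -> P x) -> exists k, J (x ^+ k).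
Proof.
move=> iJ Jx; apply: contrapT => nJ.
have [||||P [pP JP nP]] := @prime_avoiding [set y | exists k, y = x ^+ k] J.
- by exists 0%N.
- by move=> _ _ [k ->] [l ->]; exists (k + l)%N; rewrite exprD.
- by [].
- by move=> _ [k ->] Jk; apply: nJ; exists k.
by apply: (nP x); [exists 1%N | apply: Jx].
Qed.

Lemma maximal_prime I : is_maximal I -> is_prime I.
Proof.
move=> [iI I1 maxI].
have [||||P [pP IP _]] := @prime_avoiding [set 1] I => //.
- by move=> _ _ -> ->; rewrite mulr1.
- by move=> _ ->.
by rewrite -(maxI P) //; case: pP.
Qed.

Lemma local_sub n J : local_ring n -> is_ideal J -> ~ J 1 -> J `<=` n.
Proof.
move=> [_ uniq_n] iJ J1.
have [K [iK JK K1 maxK]] := noeth_max (F := fun K => ~ K 1) iJ J1.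
by rewrite -(uniq_n K).
Qed.

Lemma local_prime n P : local_ring n -> is_prime P -> P `<=` n.
Proof. by move=> ln [iP P1 _]; apply: local_sub. Qed.

(** If [J] is not prime, [a * b] in [J] with neither factor there, a prime
    above [J] is above [J + (a)] or [J + (b)]. *)
Lemma minimal_primes J : is_ideal J -> exists L : seq (set R),
  (forall Q, Q \in L -> is_prime Q /\ J `<=` Q) /\
  (forall P, is_prime P -> J `<=` P -> exists2 Q, Q \in L & Q `<=` P).
Proof.
move=> iJ; elim/noeth_ind: iJ => {}J iJ IH.
have [J1|nJ1] := pselect (J 1).
  by exists [::]; split=> // P [_ P1 _] /(_ _ J1).
have [pJ|npJ] := pselect (is_prime J).
  exists [:: J]; split=> [Q|P pP JP].
    by rewrite mem_seq1 => /eqP->; split.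
  by exists J; rewrite ?mem_head.
have [a [b [Jab nJa nJb]]] : exists a b, [/\ J (a * b), ~ J a & ~ J b].
  apply: contrapT => nab; apply: npJ; split=> // a b Jab.
  have [|nJa] := pselect (J a); first by left.
  have [|nJb] := pselect (J b); first by right.
  by exfalso; apply: nab; exists a, b.
have [La [La1 La2]] := IH _ (ideal_adjoin a iJ) (proper_adjoin iJ nJa).
have [Lb [Lb1 Lb2]] := IH _ (ideal_adjoin b iJ) (proper_adjoin iJ nJb).
exists (La ++ Lb); split=> [Q|P pP JP].
  by rewrite mem_cat => /orP[/La1|/Lb1] [pQ JQ];
      by split=> //; apply: subset_trans JQ; exact: sub_adjoin.
have [iP _ PM] := pP; case: (PM _ _ (JP _ Jab)) => Px.
  have [|Q QL QP] := La2 P pP; first exact: adjoin_min.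
  by exists Q; rewrite ?mem_cat ?QL.
have [|Q QL QP] := Lb2 P pP; first exact: adjoin_min.
by exists Q; rewrite ?mem_cat ?QL ?orbT.
Qed.

Lemma colon_max_prime J a : is_ideal J -> ~ J a ->
  exists b, [/\ ~ J b, is_prime (colon J b) & colon J a `<=` colon J b].
Proof.
move=> iJ nJa.
have [|K [iK aK [b nJb eK] maxK]] :=
  noeth_max (F := fun K => exists2 b, ~ J b & K = colon J b) (ideal_colon a iJ).
  by exists a.
rewrite {}eK in iK aK maxK *.
exists b; split=> //; split=> // [|x y Kxy]; first by rewrite /colon /= mul1r.
have [|nKy] := pselect (colon J b y); [by right | left].
have e : colon J (y * b) = colon J b.
  apply: maxK; [exact: ideal_colon | by exists (y * b) |].
  by move=> z Kz; rewrite /colon /= mulrCA; apply: idealMl.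
by rewrite -e /colon /= mulrA.
Qed.

(** Pick a prime [(J : a)].  If [(J : b)] is prime, then either some multiple
    of [b] lies in [J + (a)] but not in [J], and comparing annihilators modulo
    [J] gives [(J : b) = (J : a)], or [(J : b) = (J + (a) : b)]. *)
Lemma finite_assoc_primes J : is_ideal J -> exists L : seq (set R),
  forall b, is_prime (colon J b) -> colon J b \in L.
Proof.
move=> iJ; elim/noeth_ind: iJ => {}J iJ IH.
have [[a [nJa pa]]|nass] :=
    pselect (exists a, ~ J a /\ is_prime (colon J a)); last first.
  exists [::] => b pb; exfalso; apply: nass; exists b; split=> // Jb.
  by case: pb => _ + _; apply; rewrite /colon /= mul1r.
have [L LP] := IH _ (ideal_adjoin a iJ) (proper_adjoin iJ nJa).
exists (colon J a :: L) => b pb; rewrite inE.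
have [[r [Jrb nJrb]]|nr] :=
    pselect (exists r, adjoin J a (r * b) /\ ~ J (r * b)).
  apply/orP; left; apply/eqP; have [c Jc] := Jrb.
  have nJca : ~ J (c * a).
    by move=> Jca; apply: nJrb; rewrite -[r * b](subrK (c * a)); apply: idealD.
  have E z : J (z * (r * b)) <-> J (z * (c * a)).
    split=> Jz.
      rewrite (_ : _ * _ = z * (r * b) - z * (r * b - c * a)); last by ring.
      by apply: idealB => //; apply: idealMl.
    rewrite (_ : z * (r * b) = z * (c * a) + z * (r * b - c * a)); last by ring.
    by apply: idealD => //; apply: idealMl.
  rewrite eqEsubset; split=> z Kz.
    have [_ _ /(_ z c)[]//] := pa.
    rewrite /colon /= -mulrA; apply/E; rewrite mulrCA; exact: idealMl.
  have [_ _ /(_ z r)[]//] := pb.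
  rewrite /colon /= -mulrA; apply/E; rewrite mulrCA; exact: idealMl.
have e : colon (adjoin J a) b = colon J b.
  rewrite eqEsubset; split=> z Kz; last exact: sub_adjoin.
  by apply: contrapT => nKz; apply: nr; exists z.
by rewrite -e LP ?orbT // e.
Qed.

End IdealTheory.

(** * Prime avoidance *)

Section PrimeAvoidance.
Variables (A : comPzRingType) (m : set A).
Hypothesis im : is_ideal m.

Lemma element_outside_prime (Q : set A) (L : seq (set A)) :
    is_prime Q -> ~ (m `<=` Q) -> (forall P, P \in L -> is_ideal P) ->
  exists y, [/\ m y, ~ Q y & forall P, P \in L -> ~ (P `<=` Q) -> P y].
Proof.
move=> pQ mQ; elim: L => [_|P L IH iL].
  move/existsNP: mQ => [y /not_implyP[my Qy]].
  by exists y; split.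
have [|y [my Qy Ly]] := IH.
  by move=> P' P'L; apply: iL; rewrite in_cons P'L orbT.
have iP : is_ideal P by apply: iL; rewrite mem_head.
have [PQ|/existsNP[c /not_implyP[Pc Qc]]] := pselect (P `<=` Q).
  exists y; split=> // P'; rewrite in_cons => /orP[/eqP->//|].
  exact: Ly.
exists (c * y); split; first exact: idealMl.
  by have [_ _ QM] := pQ; move=> /QM[].
move=> P'; rewrite in_cons => /orP[/eqP-> _|P'L P'Q]; first exact: idealMr.
apply: idealMl; last exact: Ly.
by apply: iL; rewrite in_cons P'L orbT.
Qed.

(** Given [x] avoiding the primes of [L] but lying in one more prime [Q],
    correct [x] by some [y] in [m] outside [Q] that lies in all the members of
    [L] not contained in [Q]; a member contained in [Q] is avoided together
    with [Q]. *)
Lemma prime_avoidance (L : seq (set A)) :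
    (forall P, P \in L -> is_prime P /\ ~ (m `<=` P)) ->
  exists2 x, m x & forall P, P \in L -> ~ P x.
Proof.
elim: L => [_|Q L IH QL]; first by exists 0; [exact: ideal0|].
have LP P : P \in L -> is_prime P /\ ~ (m `<=` P).
  by move=> PL; apply: QL; rewrite in_cons PL orbT.
have [x mx xL] := IH LP.
have [pQ mQ] := QL Q (mem_head _ _).
have [Qx|nQx] := pselect (Q x); last first.
  by exists x => // P; rewrite in_cons => /orP[/eqP->|/xL].
have [|y [my nQy Ly]] := @element_outside_prime Q L pQ mQ.
  by move=> P /LP[/prime_ideal].
have nQxy : ~ Q (x + y).
  move=> Qxy; apply: nQy; rewrite -[y](addKr x) addrC.
  by apply: idealB => //; exact: prime_ideal.
exists (x + y) => [|P]; first exact: idealD.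
rewrite in_cons => /orP[/eqP->//|PL Pxy].
have [PQ|PQ] := pselect (P `<=` Q); first by apply: nQxy; apply: PQ.
apply: (xL P PL); rewrite -[x](addrK y).
have [pP _] := LP P PL.
by apply: idealB => //; [exact: prime_ideal | exact: Ly].
Qed.

End PrimeAvoidance.

Section Preimage.
Variables (A B : comPzRingType) (f : {rmorphism A -> B}).

Lemma preimage_ideal (I : set B) : is_ideal I -> is_ideal (f @^-1` I).
Proof.
move=> iI; split=> [|x y Ix Iy|a x Ix]; rewrite /preimage /=.
- by rewrite rmorph0; apply: ideal0.
- by rewrite rmorphD; apply: idealD.
- by rewrite rmorphM; apply: idealMl.
Qed.

Lemma preimage_prime (P : set B) : is_prime P -> is_prime (f @^-1` P).
Proof.
move=> [iP P1 PM]; split; first exact: preimage_ideal.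
  by rewrite /preimage /= rmorph1.
by move=> x y; rewrite /preimage /= rmorphM => /PM.
Qed.

Lemma prime_avoidance_morph (m : set A) (L : seq (set B)) :
    is_ideal m -> (forall P, P \in L -> is_prime P /\ ~ (f @` m `<=` P)) ->
  exists2 x, m x & forall P, P \in L -> ~ P (f x).
Proof.
move=> im LP.
have [P /mapP[Q QL ->]|x mx xL] :=
    @prime_avoidance A m im [seq f @^-1` P | P : set B <- L].
  have [pQ mQ] := LP Q QL; split; first exact: preimage_prime.
  by move=> mQ'; apply: mQ => _ [x mx <-]; apply: mQ'.
by exists x => // P PL; apply: (xL (f @^-1` P)); apply: map_f.
Qed.

Lemma preimage_adjoins (xs : seq A) (K : set B) :
    is_ideal K -> adjoins [set 0] [seq f x | x <- xs] `<=` K ->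
  adjoins [set 0] xs `<=` f @^-1` K.
Proof.
move=> iK xsK; apply: adjoins_min; first exact: preimage_ideal.
  by move=> x /= ->; rewrite /preimage /= rmorph0; exact: ideal0.
move=> x xxs; apply: xsK; apply: mem_adjoins; first exact: is_ideal_set0.
exact: map_f.
Qed.

End Preimage.

(** * Krull's height theorem *)

Section Height.
Variable R : comPzRingType.
Hypothesis noethR : noetherian R.
Implicit Types (I J K P Q T : set R) (x y z : R).

Lemma adjoins_fingen J K : is_ideal J -> is_ideal K -> J `<=` K ->
  exists s : seq R, K = adjoins J s.
Proof.
move=> iJ iK; elim/(noeth_ind noethR): iJ => {}J iJ IH JK.
have [KJ|/existsNP[a /not_implyP[Ka nJa]]] := pselect (K `<=` J).
  by exists [::]; rewrite eqEsubset.
have [|s ->] := IH _ (ideal_adjoin a iJ) (proper_adjoin iJ nJa).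
  exact: adjoin_min.
by exists (a :: s).
Qed.

(** Inclusion of the localizations at [Q]. *)
Definition locsub Q I J : Prop := forall z, I z -> exists2 s, ~ Q s & J (s * z).

(** Nakayama's lemma after localization at [Q]: an equation
    [t g = x w] modulo [J] with [w = r g] modulo [J] up to denominators makes
    a generator [g] vanish, as [t - x r] is outside [Q]. *)
Lemma nakayama_loc Q J K x : is_prime Q -> Q x -> is_ideal J -> is_ideal K ->
    J `<=` K ->
    (forall z, K z -> exists t w, [/\ ~ Q t, K w & J (t * z - x * w)]) ->
  locsub Q K J.
Proof.
move=> pQ Qx iJ iK JK; have [s eK] := adjoins_fingen iJ iK JK.
have [iQ Q1 QM] := pQ.
elim: s J iJ JK eK => [|g s IH] J iJ JK eK KJ z Kz.
  by exists 1; rewrite ?mul1r // -[J]/(adjoins J [::]) -eK.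
have Kg : K g by rewrite eK; apply: mem_adjoins; rewrite ?mem_head.
have KJg : locsub Q K (adjoin J g).
  apply: IH eK _; [exact: ideal_adjoin | exact: adjoin_min |].
  move=> z' /KJ[t [w [nQt Kw Jt]]]; exists t, w; split=> //.
  exact: sub_adjoin.
have [t [w [nQt Kw Jt]]] := KJ g Kg.
have [t' nQt' [r Jr]] := KJg w Kw.
have [u nQu [c Jc]] := KJg z Kz.
have nQ : ~ Q (t' * t - x * r).
  move=> Qtt; have : Q (t' * t).
    rewrite -[t' * t](subrK (x * r)); apply: idealD => //.
    exact: idealMr.
  by move=> /QM[].
exists ((t' * t - x * r) * u); first by move=> /QM[].
rewrite (_ : _ * z = (t' * t - x * r) * (u * z - c * g)
   + c * (t' * (t * g - x * w)) + c * x * (t' * w - r * g)); last by ring.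
by apply: idealD => //; [apply: idealD|] => //;
  do ?apply: (idealMl _ iJ).
Qed.

Lemma locsub_meet Q I J s : is_ideal J -> J s -> ~ Q s -> locsub Q I J.
Proof. by move=> iJ Js nQs z _; exists s => //; apply: idealMr. Qed.

(** [R_Q / I R_Q] is Artinian when [Q] is the only prime between [I] and [Q].
    If [a * b] lies in [I] but [a] and [b] do not, a descending chain [J k]
    above [I] is controlled by the chains [J k + (a)] and [(J k : a)], which
    lie above the larger ideals [I + (a)] and [I + (b)]. *)
Lemma artinian_loc Q I (J : nat -> set R) : is_prime Q -> is_ideal I ->
    (forall P, is_prime P -> I `<=` P -> P `<=` Q -> P = Q) ->
    (forall k, [/\ is_ideal (J k), I `<=` J k & J k.+1 `<=` J k]) ->
  exists N, forall k, (N <= k)%N -> locsub Q (J k) (J k.+1).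
Proof.
move=> pQ iI; elim/(noeth_ind noethR): iI J => {}I iI IH J IQ JP.
have iJ k : is_ideal (J k) by case: (JP k).
have IJ k : I `<=` J k by case: (JP k).
have [subIQ|/existsNP[s /not_implyP[Is nQs]]] := pselect (I `<=` Q); last first.
  by exists 0%N => k _; apply: (locsub_meet (s := s)) => //; apply: IJ.
have [iQ Q1 QM] := pQ.
have [pI|npI] := pselect (is_prime I).
  have eI : I = Q by apply: IQ.
  have [[N JNQ]|nJ] := pselect (exists N, J N `<=` Q).
    exists N => k Nk z Jz; exists 1 => //; rewrite mul1r.
    apply: IJ; rewrite eI; apply: JNQ.
    elim: k Nk Jz => [|k IHk]; first by rewrite leqn0 => /eqP->.
    rewrite leq_eqVlt => /orP[/eqP->//|Nk Jz]; apply: IHk => //.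
    by case: (JP k) => _ _; apply.
  exists 0%N => k _; move/forallNP: nJ => /(_ k.+1).
  move=> /existsNP[s /not_implyP[Js nQs]].
  exact: (locsub_meet (s := s)).
have [a [b [Iab nIa nIb]]] : exists a b, [/\ I (a * b), ~ I a & ~ I b].
  apply: contrapT => nab; apply: npI; split=> // [/subIQ//|a b Iab].
  have [|nIa] := pselect (I a); first by left.
  have [|nIb] := pselect (I b); first by right.
  by exfalso; apply: nab; exists a, b.
have [| |N1 N1P] := IH _ (ideal_adjoin a iI) (proper_adjoin iI nIa)
    (fun k => adjoin (J k) a).
- by move=> P pP IP; apply: IQ => //; apply: subset_trans IP; exact: sub_adjoin.
- move=> k; split; [exact: ideal_adjoin | exact: adjoinS |].
  by apply: adjoinS; case: (JP k).
have [| |N2 N2P] := IH _ (ideal_adjoin b iI) (proper_adjoin iI nIb)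
    (fun k => colon (J k) a).
- by move=> P pP IP; apply: IQ => //; apply: subset_trans IP; exact: sub_adjoin.
- move=> k; split; first exact: ideal_colon.
    apply: adjoin_min; first exact: ideal_colon.
      by apply: subset_trans (IJ k) _; apply: sub_colon.
    by rewrite /colon /= mulrC; apply: IJ.
  by move=> z; rewrite /colon /=; case: (JP k) => _ _; apply.
exists (maxn N1 N2) => k; rewrite geq_max => /andP[N1k N2k] z Jz.
have [s nQs [r Jr]] := N1P k N1k z (sub_adjoin a Jz).
have Jra : colon (J k) a r.
  rewrite /colon /= (_ : r * a = s * z - (s * z - r * a)); last by ring.
  apply: idealB => //; first exact: idealMl.
  by case: (JP k) => _ _; apply.
have [t nQt Jt] := N2P k N2k r Jra.
exists (t * s); first by move=> /QM[].
rewrite (_ : _ * z = t * (s * z - r * a) + t * r * a); last by ring.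
by apply: idealD => //; apply: idealMl.
Qed.

(** Krull's principal ideal theorem.  For [y] in [P], the contractions [J k]
    of [y^k R_P] (modulo [P0]) satisfy [J k = J k.+1 + x J k] locally at [Q]
    for large [k], because [x] is invertible at [P]; by Nakayama
    [J k = J k.+1] at [Q], so that [(u - r y) y^k] is in [P0] for some [u]
    outside [P]. *)
Lemma principal_ideal_theorem P0 P Q x :
    is_prime P0 -> is_prime P -> is_prime Q -> P0 `<=` P -> P `<=` Q ->
    Q x -> ~ P x ->
    (forall P', is_prime P' -> P0 `<=` P' -> P' x -> P' `<=` Q -> P' = Q) ->
  P = P0.
Proof.
move=> pP0 pP pQ P0P PQ Qx nPx Qmin.
rewrite eqEsubset; split=> // y Py.
have [iP0 P01 P0M] := pP0; have [iP P1 PM] := pP; have [iQ Q1 QM] := pQ.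
pose J k : set R := [set a | exists2 t, ~ P t & adjoin P0 (y ^+ k) (t * a)].
have iadj k : is_ideal (adjoin P0 (y ^+ k)) by apply: ideal_adjoin.
have iJ k : is_ideal (J k).
  split=> [|a b [t nPt Pa] [u nPu Pb]|a b [t nPt Pb]].
  - by exists 1; rewrite ?mulr0 //; apply: ideal0.
  - exists (t * u); first by move=> /PM[].
    rewrite (_ : _ * _ = u * (t * a) + t * (u * b)); last by ring.
    by apply: idealD => //; apply: idealMl.
  - by exists t => //; rewrite mulrCA; apply: idealMl.
have P0J k : P0 `<=` J k.
  move=> z P0z; exists 1 => //; rewrite mul1r; exact: sub_adjoin.
have Jdecr k : J k.+1 `<=` J k.
  move=> a [t nPt [r P0r]]; exists t => //; exists (r * y).
  by rewrite -mulrA -exprS.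
have [||N NP] := @artinian_loc Q _ (fun k => adjoin (J k) x) pQ
    (ideal_adjoin x iP0).
- move=> P' pP' P0P' P'Q; apply: Qmin => //.
    by apply: subset_trans P0P'; exact: sub_adjoin.
  by apply: P0P'; exact: mem_adjoin.
- by move=> k; split; [exact: ideal_adjoin | exact: adjoinS | exact: adjoinS].
have JN : locsub Q (J N) (J N.+1).
  (* [x] is a unit at [P], so [r x] in [J N] forces [r] in [J N]. *)
  apply: (@nakayama_loc _ _ _ x) => // z Jz.
  have [s nQs [r Jr]] := NP N (leqnn N) z (sub_adjoin x Jz).
  exists s, r; split=> //; last by rewrite [x * r]mulrC.
  have [t nPt Pt] : J N (r * x).
    rewrite (_ : r * x = s * z - (s * z - r * x)); last by ring.
    by apply: idealB => //; [apply: idealMl | apply: Jdecr].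
  exists (t * x); first by move=> /PM[].
  by rewrite -mulrA [x * r]mulrC.
have [|s nQs [t nPt [r P0r]]] := JN (y ^+ N).
  by exists 1; rewrite // mul1r; exact: mem_adjoin.
apply: (primeX (k := N) pP0).
have : P0 ((t * s - r * y) * y ^+ N).
  by rewrite mulrBl -[r * y * _]mulrA -exprS -[t * s * _]mulrA.
case/P0M => // /P0P Pts; exfalso.
have : P (t * s).
  by rewrite -[t * s](subrK (r * y)); apply: idealD => //; apply: idealMl.
by move=> /PM[//|/PQ].
Qed.

(** The index [k] counts the strict inclusions, as [has_prime_chain] does. *)
Fixpoint prime_chain k P T : Prop :=
  is_prime P /\
  if k is k'.+1 then exists2 P', P `<` P' & prime_chain k' P' T else P = T.

Lemma prime_chain_head k P T : prime_chain k P T -> is_prime P.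
Proof. by case: k => [|k] []. Qed.

Lemma has_prime_chainP k :
  has_prime_chain R k <-> exists P T, prime_chain k P T.
Proof.
split=> [[p [pp lep]]|[P [T]]].
  exists (p 0%N), (p k).
  elim: k p pp lep => [|k IH] p pp lep /=; first by split=> //; apply: pp.
  split; first exact: pp.
  exists (p 1%N); first exact: lep.
  by apply: (IH (fun i => p i.+1)) => i ik; [apply: pp | apply: lep].
suff H : prime_chain k P T -> exists p : nat -> set R, p 0%N = P /\
    (forall i, (i <= k)%N -> is_prime (p i)) /\
    (forall i, (i < k)%N -> p i `<` p i.+1).
  by move=> /H[p [_ ?]]; exists p.
elim: k P => [|k IH] P /= [pP].
  move=> _; exists (fun=> P); split=> //; split=> // i; by rewrite ltn0.
move=> [P' PP' /IH[p [p0 [pp lep]]]].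
exists (fun i => if i is j.+1 then p j else P); split=> //; split.
  by case=> [//|i]; apply: pp.
by case=> [_|i]; [rewrite p0 | apply: lep].
Qed.

(** In a chain ending in a prime containing [x], the primes may be moved so
    that only the first one can miss [x]; dropping that one loses one step.
    If [P < P1 <= P2] with [x] in [P2] but not in [P1], the principal ideal
    theorem puts a prime containing [P] and [x] strictly below [P2]. *)
Lemma prime_chain_shift k P T x : prime_chain k.+1 P T -> T x ->
  exists P', [/\ P `<=` P', P' x & prime_chain k P' T].
Proof.
move=> + Tx; elim: k P => [|k IH] P [pP [P1 PP1 cP1]].
  have [_ eP1] := cP1; exists P1; split=> //; last by rewrite eP1.
  by case: PP1.
have pP1 := @prime_chain_head k.+1 _ _ cP1.
have [P1x|nP1x] := pselect (P1 x).
  by exists P1; split=> //; case: PP1.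
have [P2 [P12 P2x cP2]] := IH P1 cP1.
have pP2 := prime_chain_head cP2.
apply: contrapT => nP'.
case: (PP1) => PsubP1; apply.
rewrite (_ : P1 = P) //.
apply: (principal_ideal_theorem pP pP1 pP2 _ _ P2x) => //.
move=> P' pP' PP' P'x P'P2; apply: contrapT => neP'.
apply: nP'; exists P'; split=> //; split=> //; exists P2 => //; split=> // P2P'.
by apply: neP'; rewrite eqEsubset.
Qed.

Variable n : set R.
Hypothesis ln : local_ring n.

Lemma local_max_prime : is_prime n.
Proof. by apply: maximal_prime => //; case: ln. Qed.

Lemma prime_chain_top k P T : prime_chain k.+1 P T -> prime_chain k.+1 P n.
Proof.
elim: k P => [|k IH] P [pP [P' PP' cP']].
  split=> //; exists n; last by split=> //; exact: local_max_prime.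
  case: PP' => PP' nP'P; have P'n := local_prime noethR ln (proj1 cP').
  split; first exact: subset_trans P'n.
  by move=> nP; apply: nP'P; exact: subset_trans nP.
by split=> //; exists P' => //; apply: IH.
Qed.

(** Krull's height theorem for the maximal ideal: each generator shortens a
    chain by one step. *)
Lemma krull_height J (xs : seq R) : is_ideal J -> [set` xs] `<=` n ->
    (forall P, is_prime P -> adjoins J xs `<=` P -> P = n) ->
  forall P T, J `<=` P -> ~ prime_chain (size xs).+1 P T.
Proof.
elim: xs J => [|x xs IH] J iJ xsn Jn P T JP.
  move=> [pP [P' [PP' nPP'] [pP' _]]]; apply: nPP'.
  by rewrite (Jn P) // (Jn P') //; apply: subset_trans PP'.
move=> /prime_chain_top /prime_chain_shift /(_ (xsn x (mem_head _ _))).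
move=> [P' [PP' P'x cP']].
have iP' := prime_ideal (prime_chain_head cP').
apply: (IH (adjoin J x)) cP' => //; first exact: ideal_adjoin.
  by move=> y yxs; apply: xsn; rewrite /= in_cons [_ \in _]yxs orbT.
by apply: adjoin_min => //; apply: subset_trans PP'.
Qed.

End Height.

(** * Systems of parameters in the image of an ideal *)

Section SystemsOfParameters.
Variables (A B : comPzRingType) (f : {rmorphism A -> B}).
Variables (m : set A) (n : set B).
Hypotheses (im : is_ideal m) (noethB : noetherian B) (ln : local_ring n).
Hypothesis mn : forall P : set B, is_prime P -> f @` m `<=` P -> P = n.

(** Each parameter is chosen in [m] so that its image avoids the minimal primes
    of [J] other than [n]; such primes do not contain the image of [m]. *)
Lemma parameters_exist e J : is_ideal J ->
    (forall P T, J `<=` P -> ~ prime_chain e.+1 P T) ->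
  exists xs : seq A, [/\ size xs = e, [set` xs] `<=` m &
    forall P, is_prime P -> adjoins J [seq f x | x <- xs] `<=` P -> P = n].
Proof.
have pn := local_max_prime noethB ln.
have chain1 P : is_prime P -> P <> n -> P `<` n.
  move=> pP Pn; have Psn := local_prime noethB ln pP; split=> // nP.
  by apply: Pn; rewrite eqEsubset.
elim: e J => [|e IH] J iJ Je.
  exists [::]; split=> // P pP JP; apply: contrapT => Pn.
  by apply: (Je P n JP); split=> //; exists n => //; apply: chain1.
have [L [L1 L2]] := minimal_primes noethB iJ.
have [P|x mx xL] := @prime_avoidance_morph _ _ f m
    [seq P <- L | `[< P <> n >]] im.
  rewrite mem_filter => /andP[/asboolP Pn PL]; have [pP _] := L1 P PL.
  by split=> // mP; apply: Pn; apply: mn.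
have [||xs [szxs mxs xsn]] := IH (adjoin J (f x)).
- exact: ideal_adjoin.
- move=> P T JP cP; have pP := prime_chain_head cP.
  have JsP : J `<=` P by apply: subset_trans JP; exact: sub_adjoin.
  have [Q QL QP] := L2 P pP JsP; have [pQ JQ] := L1 Q QL.
  have [Qn|Qn] := pselect (Q = n).
    case: cP => _ [P' [PP' nP'P] /(@prime_chain_head _ e) pP']; apply: nP'P.
    apply: subset_trans (local_prime noethB ln pP') _.
    by rewrite -Qn.
  apply: (Je Q T JQ); split=> //; exists P => //; split=> // PQ.
  apply: (xL Q); last by apply: PQ; apply: JP; exact: mem_adjoin.
  by rewrite mem_filter QL andbT; apply/asboolP.
exists (x :: xs); split=> /=; [by rewrite szxs | | exact: xsn].
by move=> y; rewrite /= in_cons => /orP[/eqP->//|]; apply: mxs.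
Qed.

End SystemsOfParameters.

(** * Pure homomorphisms *)

Section QuotientModule.
Variables (A : comPzRingType) (S : set A).

(** The [A]-module [A / (S)], on which purity is tested. *)
Definition qscale (a : A) (q : qring S) : qring S := qproj S a * q.

Lemma qscaleA a b q : qscale a (qscale b q) = qscale (a * b) q.
Proof. by rewrite /qscale rmorphM mulrA. Qed.

Lemma qscale1 : left_id 1 qscale.
Proof. by move=> q; rewrite /qscale rmorph1 mul1r. Qed.

Lemma qscaleDr : right_distributive qscale +%R.
Proof. by move=> a p q; rewrite /qscale mulrDr. Qed.

Lemma qscaleDl q : {morph qscale^~ q : a b / a + b}.
Proof. by move=> a b; rewrite /qscale rmorphD mulrDl. Qed.

HB.instance Definition _ := GRing.Zmodule_isLmodule.Build A (qring S)
  qscaleA qscale1 qscaleDr qscaleDl.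

Lemma qprojZ a : a *: (1 : qring S) = qproj S a.
Proof. by rewrite /GRing.scale /= /qscale mulr1. Qed.

End QuotientModule.

Section Pure.
Variables (A B : comPzRingType) (f : {rmorphism A -> B}).
Hypothesis fpure : pure f.

(** In the tensor product of [B] and [A / I], an element [b] of [I B] kills the
    class of 1; so [f a] in [I B] makes the class of [a] vanish there. *)
Lemma pure_contraction (I : set A) a :
  is_ideal I -> gen_ideal (f @` I) (f a) -> I a.
Proof.
move=> iI Ifa.
pose W : lmodType A := qring I.
have genI x : gen_ideal I x -> I x by apply; split.
have tens0r b : tens f b (0 : W) = 0.
  by apply: (addrI (tens f b 0)); rewrite -tensDr !addr0.
have tens0l (w : W) : tens f 0 w = 0.
  by apply: (addrI (tens f 0 w)); rewrite -tensDl !addr0.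
have kill : gen_ideal (f @` I) `<=`
    [set b | forall c, tens f (c * b) (1 : W) = 0].
  apply: smallest_sub; last first.
    move=> _ [x Ix <-] c /=; rewrite tensZ qprojZ (_ : qproj I x = 0) //.
    rewrite -(rmorph0 (qproj I)); apply/qprojE; rewrite subr0.
    by move=> J [_]; apply.
  split=> [c|x y x0 y0 c|b x x0 c] /=.
  - by rewrite mulr0.
  - by rewrite mulrDr tensDl x0 y0 addr0.
  - by rewrite mulrA.
have := @fpure W (qproj I a) 0.
rewrite tens0r -qprojZ -tensZ; move/(_ (kill _ Ifa 1)).
rewrite qprojZ -(rmorph0 (qproj I)) => /qprojE; rewrite subr0.
exact: genI.
Qed.

Lemma pure_noetherian : noetherian B -> noetherian A.
Proof.
move=> noethB I iI II.
have genS (X Y : set B) : X `<=` Y -> gen_ideal X `<=` gen_ideal Y.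
  move=> XY; apply: smallest_sub; first exact: gen_ideal_is_ideal.
  by apply: subset_trans XY _ => x Yx J [_]; apply.
have [||N NP] := noethB (fun k => gen_ideal (f @` I k)).
- by move=> k; apply: gen_ideal_is_ideal.
- by move=> k; apply: genS; apply: image_subset.
have sub k l : gen_ideal (f @` I k) = gen_ideal (f @` I l) -> I k `<=` I l.
  move=> e a Ia; apply: pure_contraction => //; rewrite -e => J [_]; apply.
  by exists a.
exists N => k Nk; have e := NP k Nk.
by rewrite eqEsubset; split; apply: sub.
Qed.

(** As [P B] contracts to [P], the image of the complement of [P] is a
    multiplicative set missing [P B]. *)
Lemma pure_lying_over (P : set A) : noetherian B -> is_prime P ->
  exists2 Q, is_prime Q & f @^-1` Q = P.
Proof.
move=> noethB [iP P1 PM].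
have [||||Q [pQ PQ nQ]] :=
    @prime_avoiding B noethB (f @` [set x | ~ P x]) (gen_ideal (f @` P)).
- by exists 1; rewrite ?rmorph1.
- move=> _ _ [x nPx <-] [y nPy <-]; exists (x * y); last by rewrite rmorphM.
  by move=> /PM[].
- exact: gen_ideal_is_ideal.
- by move=> _ [x nPx <-] /pure_contraction-/(_ iP).
exists Q => //; rewrite eqEsubset; split=> x.
  by move=> Qx; apply: contrapT => nPx; apply: (nQ (f x)) => //; exists x.
move=> Px; apply: PQ => J [_]; apply; by exists x.
Qed.

(** [f] induces an injection of [A/(s)] into [B/(s)B]. *)
Lemma pure_adjoins (s : seq A) a :
  adjoins [set 0] [seq f x | x <- s] (f a) -> adjoins [set 0] s a.
Proof.
move=> fs; apply: pure_contraction; first exact/ideal_adjoins/is_ideal_set0.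
apply: (adjoins_min _ _ _ fs); first exact: gen_ideal_is_ideal.
  by move=> x /= ->; exact: ideal0 (gen_ideal_is_ideal _).
move=> _ /mapP[x xs ->] J [_]; apply; exists x => //.
by apply: mem_adjoins => //; apply: is_ideal_set0.
Qed.

End Pure.

(** * Equality of dimensions *)

(** For [z] outside a prime [P] containing [S], the descending chain
    [P + (z ^ k)] becomes stationary modulo [S]; hence [z ^ k (1 - r z)] lies
    in [P] for some [r], and [P + (z)] is the whole ring. *)
Lemma artinian_prime_maximal (B : comPzRingType) (S P : set B) :
  artinian (qring S) -> is_prime P -> S `<=` P -> is_maximal P.
Proof.
move=> art pP SP; have [iP P1 PM] := pP.
have genP : gen_ideal S `<=` P by apply: smallest_sub.
split=> // J iJ J1 PJ; apply/eqP; rewrite eq_sym; apply/eqP; rewrite eqEsubset.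
split=> // z Jz; apply: contrapT => nPz.
pose I k : set (qring S) := [set q | adjoin P (z ^+ k) (repr q)].
have iadj k : is_ideal (adjoin P (z ^+ k)) by apply: ideal_adjoin.
have IP k b : I k (qproj S b) <-> adjoin P (z ^+ k) b.
  have Pb : P (repr (qproj S b) - b) by apply/genP/qprojE; exact: qprojK.
  split=> Ib.
    rewrite -[b](subKr (repr (qproj S b))); apply: idealB => //.
    exact: sub_adjoin.
  rewrite /I /= -[repr _](subrK b); apply: idealD => //; exact: sub_adjoin.
have [||N NP] := art I.
- move=> k; split=> [|x y|a x].
  + by rewrite -(rmorph0 (qproj S)); apply/IP; apply: ideal0.
  + rewrite -[x]qprojK -[y]qprojK -rmorphD => /IP Ix /IP Iy; apply/IP.
    exact: idealD.
  + rewrite -[x]qprojK -[a]qprojK -rmorphM => /IP Ix; apply/IP.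
    exact: idealMl.
- move=> k q; rewrite -[q]qprojK => /IP Iq; apply/IP.
  apply: adjoin_min Iq => //; first exact: sub_adjoin.
  by rewrite exprS; apply: idealMl => //; apply: mem_adjoin.
have : I N.+1 (qproj S (z ^+ N)).
  by rewrite (NP N.+1) //; apply/IP; exact: mem_adjoin.
move=> /IP[r]; rewrite exprS mulrA -{1}[z ^+ N]mul1r -mulrBl.
move=> /PM[/PJ Jr|/(primeX pP)//]; apply: J1.
by rewrite -[1](subrK (r * z)); apply: idealD => //; apply: idealMl.
Qed.

Section Dimension.
Variables (A B : comPzRingType) (m : set A) (n : set B).
Variable f : {rmorphism A -> B}.
Hypotheses (lm : local_ring m) (ln : local_ring n) (fmn : f @` m `<=` n).
Hypotheses (noethA : noetherian A) (noethB : noetherian B).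

Let im : is_ideal m. Proof. by case: lm => -[]. Qed.

Lemma preimage_max : f @^-1` n = m.
Proof.
have [[in_ n1 _] _] := ln; have [[_ _ maxm] _] := lm.
apply: maxm; first exact: preimage_ideal.
  by rewrite /preimage /= rmorph1.
by move=> x mx; apply: fmn; exists x.
Qed.

(** Parameters of [A] generate an ideal of [B] lying in no prime but [n], as
    [n] is the only prime of [B] over [m]. *)
Lemma chain_bound_fiber e :
    (forall Q : set B, is_prime Q -> f @` m `<=` Q -> Q = n) ->
    (forall P T : set A, ~ prime_chain e.+1 P T) ->
  forall P T : set B, ~ prime_chain e.+1 P T.
Proof.
move=> fiber Ae P T.
have mmax (Q : set A) : is_prime Q -> idfun @` m `<=` Q -> Q = m.
  move=> pQ mQ; rewrite eqEsubset; split; first exact: local_prime.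
  by move=> x mx; apply: mQ; exists x.
have [xs [szxs mxs xsm]] :=
  parameters_exist im noethA lm mmax (@is_ideal_set0 A)
    (fun P T _ => Ae P T).
rewrite map_id in xsm.
rewrite -szxs -(size_map f).
move=> cP; apply: (krull_height noethB ln (@is_ideal_set0 B) _ _ _ cP).
- move=> _ /mapP[x xxs ->]; apply: fmn; exists x => //; exact: mxs.
- move=> Q pQ xsQ; apply: fiber => // _ [x mx <-].
  suff e' : f @^-1` Q = m by rewrite -e' in mx.
  apply: xsm; first exact: preimage_prime.
  by apply: preimage_adjoins => //; exact: prime_ideal.
- by move=> x /= ->; exact: ideal0 (prime_ideal (prime_chain_head cP)).
Qed.

(** Parameters of [B] can be taken in the image of [m]; each prime of [A]
    containing them is the contraction of a prime of [B] containing them. *)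
Lemma chain_bound_contraction e :
    (forall Q : set B, is_prime Q -> f @` m `<=` Q -> Q = n) ->
    (forall P : set A, is_prime P -> exists2 Q, is_prime Q & f @^-1` Q = P) ->
    (forall P T : set B, ~ prime_chain e.+1 P T) ->
  forall P T : set A, ~ prime_chain e.+1 P T.
Proof.
move=> fiber over Be P T.
have [xs [szxs mxs xsn]] :=
  parameters_exist im noethB ln fiber (@is_ideal_set0 B)
    (fun P T _ => Be P T).
rewrite -szxs => cP.
apply: (krull_height noethA lm (@is_ideal_set0 A) mxs _ _ cP).
- move=> Q /over[Q' pQ' <-] xsQ; rewrite -preimage_max.
  congr (_ @^-1` _); apply: xsn => //.
  apply: adjoins_min; first exact: prime_ideal.
    by move=> x /= ->; exact: ideal0 (prime_ideal pQ').
  move=> _ /mapP[x xxs ->]; apply: xsQ.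
  by apply: mem_adjoins => //; apply: is_ideal_set0.
- by move=> x /= ->; exact: ideal0 (prime_ideal (prime_chain_head cP)).
Qed.

End Dimension.

Lemma krull_dim_eq (A B : comPzRingType) :
    (forall k, has_prime_chain A k <-> has_prime_chain B k) ->
  krull_dim A = krull_dim B.
Proof.
move=> AB; suff e : has_prime_chain A = has_prime_chain B.
  by rewrite /krull_dim e.
by apply/funext => k; apply/propext.
Qed.

(** * Regular sequences *)

Section RegularSequences.
Variable R : comPzRingType.
Implicit Types (I J K : set R) (x y z : R) (s t xs ys : seq R).

Definition nonzerodiv K x : Prop := forall a, K (x * a) -> K a.

(** Weak regularity on [R / J]: the quotient by the whole sequence may vanish.
    Inside a proper ideal this makes no difference. *)
Fixpoint regular_on J s : Prop :=
  if s is x :: s' then nonzerodiv J x /\ regular_on (adjoin J x) s' else True.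

Lemma regular_on_cat J s t :
  regular_on J (s ++ t) <-> regular_on J s /\ regular_on (adjoins J s) t.
Proof.
elim: s J => [|x s IH] J /=; first by split=> // -[].
by split=> [[rx /IH[]]|[[rx rs] rt]]; [|split=> //; apply/IH].
Qed.

Lemma regular_on_rcons J s x :
  regular_on J (rcons s x) <-> regular_on J s /\ nonzerodiv (adjoins J s) x.
Proof.
rewrite -cats1; split=> [/regular_on_cat[rs []]//|[rs rx]].
by apply/regular_on_cat.
Qed.

Lemma regular_onP J s : regular_on J s <->
  forall i, (i < size s)%N -> nonzerodiv (adjoins J (take i s)) s`_i.
Proof.
elim: s J => [|x s IH] J; first by split.
split=> [[rx /IH rs] [|i] //= ilt|rs]; first exact: rs.
split; first exact: (rs 0%N).
by apply/IH => i ilt; apply: (rs i.+1).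
Qed.

Lemma lreg_qprojP s x :
  GRing.lreg (qproj [set` s] x) <-> nonzerodiv (adjoins [set 0] s) x.
Proof.
rewrite -gen_idealE; split=> [rx a xa|rx p q].
  rewrite -[a]subr0; apply/qprojE; apply: rx.
  by rewrite -!rmorphM; apply/qprojE; rewrite mulr0 subr0.
rewrite -[p]qprojK -[q]qprojK -!rmorphM => /qprojE e; apply/qprojE.
by apply: rx; rewrite mulrBr.
Qed.

Lemma regular_seqP s :
  regular_seq s <-> regular_on [set 0] s /\ ~ adjoins [set 0] s 1.
Proof.
have E1 : (1 : qring [set` s]) = 0 <-> adjoins [set 0] s 1.
  rewrite -gen_idealE -(rmorph1 (qproj [set` s])) -(rmorph0 (qproj [set` s])).
  by split=> [/qprojE|h]; [|apply/qprojE]; rewrite subr0.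
split=> -[rs ns]; split.
- by apply/regular_onP => i /rs /lreg_qprojP.
- by move=> /E1.
- by move/regular_onP: rs => rs i /rs /lreg_qprojP.
- by move=> /E1.
Qed.

(** For ideals [I] and [K] of a Noetherian ring, this says that [I] consists of
    zero divisors modulo [K]; the form with one witness [u] is the one that can
    be transported along exchanges. *)
Definition annihilates I K : Prop :=
  exists2 u, ~ K u & forall a, I a -> K (a * u).

Lemma nonzerodiv_annihilates I K x : I x -> nonzerodiv K x -> ~ annihilates I K.
Proof. by move=> Ix rx [u nKu Ku]; apply: nKu; apply: rx; apply: Ku. Qed.

(** If [x v = z u] modulo [K], then [u] is killed by [I] modulo [K + (x)] if
    and only if [v] is killed by [I] modulo [K + (z)]. *)
Lemma annihilates_exchange I K x z : is_ideal K -> I z ->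
    nonzerodiv K x -> nonzerodiv K z ->
  annihilates I (adjoin K x) -> annihilates I (adjoin K z).
Proof.
move=> iK Iz rx rz [u nu uK]; have [v Kv] := uK z Iz.
exists v => [[w Kw]|a Ia].
  apply: nu; exists w; apply: rz.
  rewrite (_ : _ * _ = z * u - v * x + x * (v - w * z)); last by ring.
  by apply: idealD => //; apply: idealMl.
have [c Kc] := uK a Ia; exists c; apply: rx.
rewrite (_ : _ * _ = z * (a * u - c * x) - a * (z * u - v * x)); last by ring.
by apply: idealB => //; apply: idealMl.
Qed.

Fixpoint prefix_ideals J s : seq (set R) :=
  J :: (if s is x :: s' then prefix_ideals (adjoin J x) s' else [::]).

Lemma prefix_ideals_head J s : J \in prefix_ideals J s.
Proof. by case: s => [|x s] /=; rewrite mem_head. Qed.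

Lemma prefix_ideals_last J s : adjoins J s \in prefix_ideals J s.
Proof.
by elim: s J => [|x s IH] J /=; rewrite ?mem_head // in_cons IH orbT.
Qed.

Lemma prefix_ideals_rcons I J s x K : is_ideal J -> [set` rcons s x] `<=` I ->
    regular_on J (rcons s x) -> K \in prefix_ideals J s ->
  is_ideal K /\ ~ annihilates I K.
Proof.
elim: s J => [|y s IH] J iJ sI /= [ry rs]; rewrite in_cons.
  rewrite orbF => /eqP->; split=> //; apply: nonzerodiv_annihilates ry.
  by apply: sI; rewrite /= mem_head.
move=> /orP[/eqP->|KL].
  split=> //; apply: nonzerodiv_annihilates ry.
  by apply: sI; rewrite /= mem_head.
apply: (IH (adjoin J y)) => //; first exact: ideal_adjoin.
by move=> z zs; apply: sI; rewrite /= in_cons [_ \in _]zs orbT.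
Qed.

(** A nonzerodivisor modulo all the ideals [J + (x_1, .., x_i)] can be put in
    front of the sequence: if [x a = z b] modulo the ideal before [x], then
    [b] is a multiple of [x] modulo that ideal, and [x] can be cancelled. *)
Lemma regular_on_adjoin J s z : is_ideal J -> regular_on J s ->
    (forall K, K \in prefix_ideals J s -> nonzerodiv K z) ->
  regular_on (adjoin J z) s.
Proof.
elim: s J => [//|x s IH] J iJ [rx rs] rz; split; last first.
  rewrite adjoinC; apply: IH => //; first exact: ideal_adjoin.
  by move=> K KL; apply: rz; rewrite /= in_cons KL orbT.
have rxz : nonzerodiv (adjoin J x) z.
  by apply: rz; rewrite /= in_cons prefix_ideals_head orbT.
move=> a [b Jb]; have [|c Jc] := rxz b.
  exists a; rewrite (_ : _ - _ = - 1 * (x * a - b * z)); last by ring.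
  exact: idealMl.
exists c; apply: rx.
rewrite (_ : _ * _ = (x * a - b * z) + z * (b - c * x)); last by ring.
by apply: idealD => //; apply: idealMl.
Qed.

End RegularSequences.

Section RegularElements.
Variables (A B : comPzRingType) (f : {rmorphism A -> B}) (m : set A).
Hypotheses (im : is_ideal m) (noethB : noetherian B).

(** The zero divisors modulo the ideals of [Ks] form a finite union of primes
    [(K : b)], and none of these primes contains the image of [m]. *)
Lemma nonzerodiv_exists (Ks : seq (set B)) :
    (forall K, K \in Ks -> is_ideal K /\ ~ annihilates (f @` m) K) ->
  exists2 x, m x & forall K, K \in Ks -> nonzerodiv K (f x).
Proof.
move=> KsP.
have [L [L1 L2]] : exists L : seq (set B),
    (forall Q, Q \in L -> is_prime Q /\ ~ (f @` m `<=` Q)) /\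
    (forall y, (forall Q, Q \in L -> ~ Q y) ->
       forall K, K \in Ks -> nonzerodiv K y).
  elim: Ks KsP => [_|K Ks IH KsP]; first by exists [::]; split.
  have [|L [L1 L2]] := IH.
    by move=> K' K'K; apply: KsP; rewrite in_cons K'K orbT.
  have [iK nK] := KsP K (mem_head _ _).
  have [LK LKP] := finite_assoc_primes noethB iK.
  pose good (Q : set B) := exists b, [/\ ~ K b, is_prime Q & Q = colon K b].
  exists ([seq Q <- LK | `[< good Q >]] ++ L); split=> [Q|y yL K'].
    rewrite mem_cat => /orP[|/L1//]; rewrite mem_filter => /andP[/asboolP].
    move=> [b [nKb pQ eQ]] _; split=> // mQ; apply: nK; exists b => // a ma.
    by have := mQ a ma; rewrite eQ.
  rewrite in_cons => /orP[/eqP->|]; last first.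
    by apply: L2 => Q QL; apply: yL; rewrite mem_cat QL orbT.
  move=> a Kya; apply: contrapT => nKa.
  have [b [nKb pb ab]] := colon_max_prime noethB iK nKa.
  apply: (yL (colon K b)); last exact: ab.
  rewrite mem_cat mem_filter LKP // andbT; apply/orP; left.
  by apply/asboolP; exists b.
have [x mx xL] := @prime_avoidance_morph _ _ f m L im L1.
by exists x => //; apply: L2.
Qed.

End RegularElements.

(** * Depth *)

Section DepthTheory.
Variables (R : comPzRingType) (I : set R).
Hypotheses (noethR : noetherian R) (iI : is_ideal I).

Lemma nonzerodiv_exists_id (Ks : seq (set R)) :
    (forall K, K \in Ks -> is_ideal K /\ ~ annihilates I K) ->
  exists2 x, I x & forall K, K \in Ks -> nonzerodiv K x.
Proof.
move=> KsP; apply: (@nonzerodiv_exists _ _ idfun I iI noethR Ks).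
by move=> K /KsP; rewrite image_id.
Qed.

(** Whether [I] consists of zero divisors modulo a regular sequence depends
    only on its length.  Prime avoidance gives [z] in [I] which is a
    nonzerodivisor modulo all proper prefixes of both sequences; exchange the
    last terms of both with [z], put [z] in front, and induct modulo [z]. *)
Lemma annihilates_regular J xs ys : is_ideal J -> size xs = size ys ->
    [set` xs] `<=` I -> [set` ys] `<=` I ->
    regular_on J xs -> regular_on J ys ->
  annihilates I (adjoins J xs) -> annihilates I (adjoins J ys).
Proof.
move=> + + + +; move e : (size xs) => k.
elim: k J xs ys e => [|k IH] J xs ys.
  by move=> /size0nil-> _ /esym/size0nil->.
case/lastP: xs => [//|xs x]; rewrite size_rcons => -[szx] iJ.
case/lastP: ys => [//|ys y]; rewrite size_rcons => -[szy] xsI ysI rxs rys.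
have [|z Iz rz] :=
    @nonzerodiv_exists_id (prefix_ideals J xs ++ prefix_ideals J ys).
  move=> K; rewrite mem_cat => /orP[].
    exact: prefix_ideals_rcons rxs.
  exact: prefix_ideals_rcons rys.
have rzx K : K \in prefix_ideals J xs -> nonzerodiv K z.
  by move=> KL; apply: rz; rewrite mem_cat KL.
have rzy K : K \in prefix_ideals J ys -> nonzerodiv K z.
  by move=> KL; apply: rz; rewrite mem_cat KL orbT.
have sub_rcons (s : seq R) w : [set` rcons s w] `<=` I -> [set` s] `<=` I.
  by move=> sI v vs; apply: sI; rewrite /= mem_rcons in_cons [_ \in _]vs orbT.
have Iy : I y by apply: ysI; rewrite /= mem_rcons mem_head.
move/regular_on_rcons: rxs => [rxs rx]; move/regular_on_rcons: rys => [rys ry].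
rewrite !adjoins_rcons.
move=> /(annihilates_exchange (ideal_adjoins _ iJ) Iz rx).
move=> /(_ (rzx _ (prefix_ideals_last _ _))).
rewrite -adjoins_adjoin => ann.
have rzys := rzy _ (prefix_ideals_last J ys).
apply: (annihilates_exchange (ideal_adjoins _ iJ) Iy rzys ry).
rewrite -adjoins_adjoin.
apply: IH ann => //; first exact: ideal_adjoin; first exact: sub_rcons xsI.
- exact: sub_rcons ysI.
- exact: regular_on_adjoin.
- exact: regular_on_adjoin.
Qed.

Hypothesis I1 : ~ I 1.

Lemma adjoins_proper s : [set` s] `<=` I -> ~ adjoins [set 0] s 1.
Proof.
move=> sI s1; apply: I1; apply: adjoins_min s1 => //.
by move=> x /= ->; apply: ideal0.
Qed.

Lemma regular_seq_sub s : [set` s] `<=` I ->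
  regular_seq s <-> regular_on [set 0] s.
Proof.
move=> sI; split=> [/regular_seqP[]//|rs]; apply/regular_seqP; split=> //.
exact: adjoins_proper.
Qed.

Lemma rcons_sub s x : [set` s] `<=` I -> I x -> [set` rcons s x] `<=` I.
Proof.
by move=> sI Ix y; rewrite /= mem_rcons in_cons => /orP[/eqP->//|/sI].
Qed.

Lemma maximal_regular_seqP s : maximal_regular_seq I s <->
  [/\ regular_on [set 0] s, [set` s] `<=` I &
      annihilates I (adjoins [set 0] s)].
Proof.
split=> [[rs sI maxs]|[rs sI ann]]; split=> //.
- by move/regular_seqP: rs => [].
- apply: contrapT => nann.
  have [|x Ix rx] := @nonzerodiv_exists_id [:: adjoins [set 0] s].
    move=> K; rewrite mem_seq1 => /eqP->; split=> //.
    exact/ideal_adjoins/is_ideal_set0.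
  apply: (maxs x Ix); apply/regular_seq_sub; first exact: rcons_sub.
  apply/regular_on_rcons; split; last by apply: rx; rewrite mem_seq1.
  by move/regular_seqP: rs => [].
- exact/regular_seq_sub.
- move=> x Ix /regular_seqP[/regular_on_rcons[_ rx] _].
  exact: nonzerodiv_annihilates rx ann.
Qed.

Lemma maximal_regular_seq_exists s : regular_seq s -> [set` s] `<=` I ->
  exists2 t, maximal_regular_seq I t & (size s <= size t)%N.
Proof.
move e : (adjoins [set 0] s) => K.
have iK : is_ideal K by rewrite -e; exact/ideal_adjoins/is_ideal_set0.
elim/(noeth_ind noethR): iK s e => {}K iK IH s e rs sI.
have [maxs|] := pselect (forall x, I x -> ~ regular_seq (rcons s x)).
  by exists s.
move=> /existsNP[x /not_implyP[Ix /contrapT rsx]].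
have [||||t maxt lt] := IH (adjoin K x) _ _ (rcons s x) _ rsx.
- exact: ideal_adjoin.
- apply: proper_adjoin => // Kx.
  move/regular_seqP: rsx => [/regular_on_rcons[_ rx] _].
  apply: (adjoins_proper sI); apply: rx.
  by rewrite mulr1 e.
- by rewrite adjoins_rcons e.
- exact: rcons_sub.
by exists t => //; apply: leq_trans lt; rewrite size_rcons.
Qed.

Lemma maximal_regular_seq_size s t :
  maximal_regular_seq I s -> maximal_regular_seq I t -> size s = size t.
Proof.
have H u v : maximal_regular_seq I u -> maximal_regular_seq I v ->
    (size v <= size u)%N.
  move=> /maximal_regular_seqP[ru uI annu] /maximal_regular_seqP[rv vI annv].
  rewrite leqNgt; apply/negP => ltuv.
  have ev : v = take (size u) v ++ v`_(size u) :: drop (size u).+1 v.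
    by rewrite -drop_nth // cat_take_drop.
  move: rv; rewrite ev => /regular_on_cat[rv [rx _]].
  have Ix : I v`_(size u) by apply: vI; rewrite /= mem_nth.
  apply: (nonzerodiv_annihilates Ix rx).
  apply: annihilates_regular annu => //; first exact: is_ideal_set0.
    by rewrite size_takel // ltnW.
  by move=> x xv; apply: vI; exact: mem_take xv.
by move=> ms mt; apply/eqP; rewrite eqn_leq !H.
Qed.

Lemma regular_seq_depth s : regular_seq s -> [set` s] `<=` I ->
  (size s <= depth I)%N.
Proof.
move=> rs sI; have [t maxt lt] := maximal_regular_seq_exists rs sI.
rewrite (_ : depth I = size t) //; apply: xget_unique.
  by split; [exists t | move=> u maxu; apply: maximal_regular_seq_size].
by move=> d [_ dP]; rewrite (dP t maxt).
Qed.

End DepthTheory.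

(** If the image of [m] killed a nonzero element modulo [K], then so would
    powers of each element [x] of [n], since the colon ideal of that element
    lies in no prime but [n]; hence [x] would be a zero divisor. *)
Lemma regular_element_from_fiber (A B : comPzRingType)
    (f : {rmorphism A -> B}) (m : set A) (n K : set B) (x : B) :
    is_ideal m -> noetherian B ->
    (forall Q : set B, is_prime Q -> f @` m `<=` Q -> Q = n) ->
    is_ideal K -> n x -> nonzerodiv K x ->
  exists2 y, m y & nonzerodiv K (f y).
Proof.
move=> im noethB fiber iK nx rx.
have [|y my ry] := @nonzerodiv_exists _ _ f m im noethB [:: K]; last first.
  by exists y => //; apply: ry; rewrite mem_seq1.
move=> K'; rewrite mem_seq1 => /eqP->; split=> // -[u nKu uK].
have [|k] := @radical_primes _ noethB (colon K u) x (ideal_colon u iK).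
  by move=> P pP uP; rewrite (fiber P) //; apply: subset_trans uP.
rewrite /colon /=; elim: k => [|k IH]; first by rewrite expr0 mul1r.
by rewrite exprS -mulrA => /rx.
Qed.

(** Maximal regular sequences of [B] in [n] can be taken in the image of [m],
    and a regular sequence of [B] coming from [A] is regular in [A]. *)
Lemma regular_seq_from_fiber (A B : comPzRingType) (f : {rmorphism A -> B})
    (m : set A) (n : set B) (d : nat) :
    pure f -> is_ideal m -> is_ideal n -> ~ n 1 -> f @` m `<=` n ->
    noetherian B ->
    (forall Q : set B, is_prime Q -> f @` m `<=` Q -> Q = n) ->
    (forall s, maximal_regular_seq n s -> size s = d) ->
  exists s : seq A, [/\ size s = d, [set` s] `<=` m & regular_on [set 0] s].
Proof.
move=> fpure im in_ n1 fmn noethB fiber maxd.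
have fsn (s : seq A) : [set` s] `<=` m -> [set` [seq f x | x <- s]] `<=` n.
  by move=> sm _ /mapP[x xs ->]; apply: fmn; exists x => //; apply: sm.
suff [s [szs sm rs]] : exists s : seq A, [/\ size s = d, [set` s] `<=` m &
    regular_on [set 0] [seq f x | x <- s]].
  exists s; split=> //; apply/regular_onP => i ilt a.
  move/regular_onP: rs => /(_ i); rewrite size_map => /(_ ilt) ri sa.
  apply: (pure_adjoins fpure); rewrite map_take.
  apply: ri; rewrite (nth_map 0) // -rmorphM -map_take.
  have := @preimage_adjoins _ _ f _ _ (ideal_adjoins _ (is_ideal_set0 B))
    (@subset_refl _ (adjoins [set 0] [seq f x | x <- take i s])).
  by move/(_ _ sa).
suff H k : (k <= d)%N -> exists s : seq A, [/\ size s = k, [set` s] `<=` m &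
    regular_on [set 0] [seq f x | x <- s]] by exact: H.
elim: k => [|k IH] kd; first by exists [::].
have [s [szs sm rs]] := IH (ltnW kd).
have rfs : regular_seq [seq f x | x <- s].
  by apply/(regular_seq_sub in_ n1) => //; apply: fsn.
have [x [nx /regular_seqP[/regular_on_rcons[_ rx] _]]] :
    exists x, n x /\ regular_seq (rcons [seq f x | x <- s] x).
  apply: contrapT => nx.
  have := maxd [seq f x | x <- s]; rewrite size_map szs => dk.
  suff ek : k = d by rewrite ek ltnn in kd.
  apply: dk; split=> //; first exact: fsn.
  by move=> x nx' rx; apply: nx; exists x.
have [y my ry] := regular_element_from_fiber im noethB fiber
  (ideal_adjoins _ (is_ideal_set0 B)) nx rx.
exists (rcons s y); split; first by rewrite size_rcons szs.
  by move=> z; rewrite /= mem_rcons in_cons => /orP[/eqP->//|/sm].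
by rewrite map_rcons; apply/regular_on_rcons.
Qed.

(** * The comparison of dimension and depth *)

Unset Implicit Arguments.

Theorem proposition2p6 (A B : comPzRingType) (m : set A) (n : set B)
    (f : {rmorphism A -> B})
    (hA : local_ring m) (hB : local_ring n)
    (hlocal : f @` m `<=` n)
    (hpure : pure f)
    (hnoeth : noetherian B)
    (hart : artinian (qring (f @` m))) :
  krull_dim A = krull_dim B /\ (depth n <= depth m)%N.
Proof.
have noethA := pure_noetherian hpure hnoeth.
have [[im m1 _] _] := hA; have [[in_ n1 _] uniq_n] := hB.
have fiber Q : is_prime Q -> f @` m `<=` Q -> Q = n.
  by move=> pQ mQ; apply: uniq_n; apply: artinian_prime_maximal mQ.
split.
  apply: krull_dim_eq => -[|k].
    split=> _; apply/has_prime_chainP.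
      by exists n, n; split=> //; exact: local_max_prime hB.
    by exists m, m; split=> //; exact: local_max_prime hA.
  have absent (R : comPzRingType) : ~ has_prime_chain R k.+1 ->
      forall P T : set R, ~ prime_chain k.+1 P T.
    by move=> nR P T cP; apply/nR/has_prime_chainP; exists P, T.
  split=> /has_prime_chainP[P [T cP]]; apply: contrapT => /absent none.
    have over P' : is_prime P' -> exists2 Q, is_prime Q & f @^-1` Q = P'.
      exact: pure_lying_over.
    exact: (chain_bound_contraction hA hB hlocal noethA hnoeth fiber over none
      cP).
  exact: (chain_bound_fiber hA hB hlocal noethA hnoeth fiber none cP).
have [[d dP]|nd] := pselect (exists d, is_depth n d); last first.
  have -> // : depth n = 0%N.
  by apply: xgetPN => d dP; apply: nd; exists d.
have -> : depth n = d.
  apply: xget_unique => // d' [_ d'P].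
  by have [[s maxs] dP'] := dP; rewrite -(d'P s maxs) -(dP' s maxs).
have [_ maxd] := dP.
have [s [<- sm rs]] :=
  regular_seq_from_fiber hpure im in_ n1 hlocal hnoeth fiber maxd.
by apply: regular_seq_depth => //; apply/(regular_seq_sub im m1).
Qed.
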